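(* Let $u_\alpha^\delta\in\Omega$ be the regularized minimizer of $F_\alpha(\cdot,v^\delta)$, where the initial guess $u^0\in\mathbb{R}^N$ is some constant vector, let the minimum norm solution $u^\dagger$ satisfy the variational source condition $$\sigma\|u-u^\dagger\|\le\mathcal J(u)-\mathcal J(u^\dagger)+\Psi(\|Tu-Tu^\dagger\|)\quad\text{for all }u\in\mathbb{R}^N ,$$ and let the regularization parameter be chosen a posteriori, $\alpha=\alpha(\delta,v^\delta)\in\overline S\cap\underline S$. Then $$E(u_\alpha^\delta,u^\dagger)=\mathcal O(\Psi(\delta)).$$
   Context: $\mathcal X=\mathbb{R}^N$, $\mathcal Y=\mathbb{R}^M$ with Euclidean norm $\|\cdot\|$; $T:\mathcal X\to\mathcal Y$ is linear and injective. $\Omega=\{u\in\mathbb{R}^N: u_i\ge 0 \text{ for all } i\}$ and $h$ is its indicator function ($0$ on $\Omega$, $\infty$ off $\Omega$). $D=\nabla$ is the linear discrete gradient operator, $g=\|\cdot\|_1$, and $\mathcal J(u)=g(Du)=\|Du\|_1$ is the discrete total variation. For $\alpha>0$, $F_\alpha(u,v^\delta)=\frac12\|Tu-v^\delta\|^2+\alpha D_{\mathcal J}(u,u^0)+h(u)$, where $D_{\mathcal J}(u,u^0)=\mathcal J(u)-\mathcal J(u^0)-\langle D^T\hat w^0,u-u^0\rangle$ with $\hat w^0\in\partial g(Du^0)$; for constant $u^0$ one has $Du^0=0$ and $\hat w^0=0$ is taken. $u_\alpha^\delta$ denotes a minimizer of $F_\alpha(\cdot,v^\delta)$ over $\mathbb{R}^N$.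 Data: $v^\dagger\in\mathrm{range}(T)$ is the noiseless measurement and $v^\delta\in\mathcal Y$ satisfies $\|v^\dagger-v^\delta\|\le\delta$, $\delta>0$. The minimum norm solution $u^\dagger\in\Omega$ satisfies $Tu^\dagger=v^\dagger$ and has minimal norm among the (nonnegative, bounded variation) solutions of $Tu=v^\dagger$. In the variational source condition $\sigma\in(0,1]$ is a constant and $\Psi:[0,\infty)\to[0,\infty)$ is a concave, monotonically increasing function with $\Psi(0)=0$. Discrepancy principle: for fixed $1<\underline\tau\le\overline\tau<\infty$, $\overline S=\{\alpha>0:\|Tu_\alpha^\delta-v^\delta\|\le\overline\tau\delta\}$ and $\underline S=\{\alpha>0:\underline\tau\delta\le\|Tu_\alpha^\delta-v^\delta\|\}$. Total error functional: $E(u_\alpha^\delta,u^\dagger)=\Lambda\|u_\alpha^\delta-u^\dagger\|$, where $\Lambda\in\mathbb{R}_+$ is a coefficient depending only on $\mathcal J$ and its domain. $\mathcal O(\Psi(\delta))$ is meant as $\delta\to0$, with a constant independent of $\delta$, $v^\delta$ and $\alpha$ (it may depend on $\underline\tau,\overline\tau,\sigma,\Lambda$). *)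

(* Defs.v *)
From HB Require Import structures.
From mathcomp Require Import all_boot all_order all_algebra.
From mathcomp Require Import all_classical all_reals all_analysis.
Set Implicit Arguments.
Unset Strict Implicit.
Unset Printing Implicit Defensive.
Import Order.TTheory GRing.Theory Num.Theory.
Import numFieldNormedType.Exports.
Local Open Scope classical_set_scope.
Local Open Scope ring_scope.

(* The library norm on matrices is the maximum norm, hence these definitions. *)
Definition dot (R : realType) (n : nat) (u v : 'cV[R]_n) : R :=
  \sum_i u i 0 * v i 0.

Definition enorm (R : realType) (n : nat) (u : 'cV[R]_n) : R :=
  Num.sqrt (dot u u).

Definition l1norm (R : realType) (n : nat) (u : 'cV[R]_n) : R :=
  \sum_i `|u i 0|.

(* A d-dimensional box of pixels with side lengths s; an image is a vector
   indexed by 'I_N through an enumeration e : 'I_N -> pixel s of the pixels. *)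
Definition pixel (d : nat) (s : 'I_d -> nat) : finType :=
  {dffun forall k : 'I_d, 'I_(s k)}.

(* Pixel j is the successor of pixel i in direction k. *)
Definition succ_pixel (d : nat) (s : 'I_d -> nat) (N : nat)
    (e : 'I_N -> pixel s) (k : 'I_d) (i j : 'I_N) : bool :=
  [forall l : 'I_d, (e j l : nat) == e i l + (l == k)]%N.

(* Forward difference in direction k: (D_k u)_i = u_j - u_i if j is the
   successor of i, and 0 if i has no successor (Neumann boundary). *)
Definition fwd_diff (R : realType) (d : nat) (s : 'I_d -> nat) (N : nat)
    (e : 'I_N -> pixel s) (k : 'I_d) : 'M[R]_N :=
  \matrix_(i, j) if [exists j', succ_pixel e k i j']
                 then (succ_pixel e k i j)%:R - (j == i)%:R else 0.

(* The directional differences D_0, ..., D_(d-1) stacked on top of each other. *)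
Definition grad (R : realType) (d : nat) (s : 'I_d -> nat) (N : nat)
    (e : 'I_N -> pixel s) : 'M[R]_(\sum_(k < d) N, N) :=
  \mxcol_(k < d) fwd_diff R e k.

Definition TV (R : realType) (d : nat) (s : 'I_d -> nat) (N : nat)
    (e : 'I_N -> pixel s) (u : 'cV[R]_N) : R :=
  l1norm (grad R e *m u).

Definition subdiff (R : realType) (n : nat) (f : 'cV[R]_n -> R)
    (x : 'cV[R]_n) : set 'cV[R]_n :=
  [set p | forall y, f x + dot p (y - x) <= f y].

Definition bregman (R : realType) (n : nat) (f : 'cV[R]_n -> R)
    (p u u0 : 'cV[R]_n) : R :=
  f u - f u0 - dot p (u - u0).

Definition nonneg_orthant (R : realType) (n : nat) : set 'cV[R]_n :=
  [set u | forall i, 0 <= u i 0].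
Arguments nonneg_orthant : clear implicits.

Definition set_indicator (R : realType) (n : nat) (A : set 'cV[R]_n)
    (u : 'cV[R]_n) : \bar R :=
  if u \in A then 0%E else +oo%E.

(* w0 is the chosen element of the subdifferential of the l1 norm at
   grad u0. *)
Definition objective (R : realType) (d : nat) (s : 'I_d -> nat) (N M : nat)
    (e : 'I_N -> pixel s) (T : 'cV[R]_N -> 'cV[R]_M)
    (u0 : 'cV[R]_N) (w0 : 'cV[R]_(\sum_(k < d) N))
    (alpha : R) (v : 'cV[R]_M) (u : 'cV[R]_N) : \bar R :=
  ((2^-1 * enorm (T u - v) ^+ 2
    + alpha * bregman (TV e) ((grad R e)^T *m w0) u u0)%:E
   + set_indicator (nonneg_orthant R N) u)%E.

Definition is_minimizer (X : Type) (R : realType) (F : X -> \bar R)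
    (x : X) : Prop :=
  forall y, (F x <= F y)%E.

Definition min_norm_solution (R : realType) (N M : nat)
    (T : 'cV[R]_N -> 'cV[R]_M) (v : 'cV[R]_M) (u : 'cV[R]_N) : Prop :=
  [/\ nonneg_orthant R N u, T u = v &
      forall w, nonneg_orthant R N w -> T w = v -> enorm u <= enorm w].

Definition source_condition (R : realType) (N M : nat)
    (T : 'cV[R]_N -> 'cV[R]_M) (J : 'cV[R]_N -> R) (sigma : R)
    (Psi : R -> R) (udag : 'cV[R]_N) : Prop :=
  forall u, sigma * enorm (u - udag)
            <= J u - J udag + Psi (enorm (T u - T udag)).

(* Psi : [0, +oo[ -> [0, +oo[ is represented by a function on R of which only
   the restriction to [0, +oo[ matters. *)
Definition index_function (R : realType) (Psi : R -> R) : Prop :=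
  [/\ forall t, 0 <= t -> 0 <= Psi t,
      convex_function (`[0, +oo[ : set R^o) (fun t => - Psi t),
      forall x y, 0 <= x -> x <= y -> Psi x <= Psi y
    & Psi 0 = 0].

(* Below, ua maps each alpha > 0 to the corresponding regularized solution. *)
Definition discrepancy_upper (R : realType) (N M : nat)
    (T : 'cV[R]_N -> 'cV[R]_M) (tau delta : R) (v : 'cV[R]_M)
    (ua : R -> 'cV[R]_N) : set R :=
  [set alpha | 0 < alpha /\ enorm (T (ua alpha) - v) <= tau * delta].

Definition discrepancy_lower (R : realType) (N M : nat)
    (T : 'cV[R]_N -> 'cV[R]_M) (tau delta : R) (v : 'cV[R]_M)
    (ua : R -> 'cV[R]_N) : set R :=
  [set alpha | 0 < alpha /\ tau * delta <= enorm (T (ua alpha) - v)].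

Definition total_error (R : realType) (N : nat) (Lambda : R)
    (u udag : 'cV[R]_N) : R :=
  Lambda * enorm (u - udag).

Lemma grad_const (R : realType) (d : nat) (s : 'I_d -> nat) (N : nat)
    (e : 'I_N -> pixel s) (c : R) :
  injective e -> grad R e *m const_mx c = 0 :> 'cV[R]_(\sum_(k < d) N).
Proof.
move=> e_inj; apply/mxcolP => k; rewrite /grad mxcol_mul mxcolK.
have -> : submxcol (0 : 'cV[R]_(\sum_(k < d) N)) k = 0.
  by apply/matrixP => i j; rewrite !mxE.
apply/matrixP => i j; rewrite mxE [RHS]mxE.
under eq_bigr do rewrite !mxE.
case: (boolP [exists j', succ_pixel e k i j']) => [/existsP[j' hj']|_]; last first.
  by rewrite big1 // => l _; exact: mul0r.
have succE j1 : succ_pixel e k i j1 = (j1 == j').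
  apply/idP/eqP => [/forallP h|->//]; apply: e_inj; apply/ffunP => l.
  by apply: val_inj; rewrite /= (eqP (h l)) (eqP (forallP hj' l)).
under eq_bigr do rewrite succE mulrBl.
rewrite sumrB (bigD1 j') //= [X in _ - X](bigD1 i) //= !eqxx.
by rewrite !big1 ?subrr // => l /negPf ->; rewrite mul0r.
Qed.

(* The choice w0 = 0 is admissible for constant u0. *)
Lemma subdiff_l1norm_grad_const (R : realType) (d : nat) (s : 'I_d -> nat)
    (N : nat) (e : 'I_N -> pixel s) (c : R) :
  injective e ->
  subdiff (@l1norm R _) (grad R e *m (const_mx c : 'cV[R]_N)) 0.
Proof.
move=> e_inj y; rewrite grad_const // /l1norm /dot.
rewrite big1 => [|i _]; last by rewrite mxE normr0.
rewrite big1 => [|i _]; last by rewrite mxE mul0r.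
by rewrite addr0; apply: sumr_ge0.
Qed.

(* Main.v *)
Require Import Defs.
From HB Require Import structures.
From mathcomp Require Import all_boot all_order all_algebra.
From mathcomp Require Import all_classical all_reals all_analysis.
From mathcomp Require Import ring lra.
Import Order.TTheory GRing.Theory Num.Theory.
Import numFieldNormedType.Exports.
Local Open Scope classical_set_scope.
Local Open Scope ring_scope.

(** The regularization term is compared at the regularized solution
    [u = ua alpha] and at the exact solution [udag].  Both are nonnegative, so
    minimality of [u], the subgradient at [u0] being zero and TV(u0) cancelling,
    gives
      1/2 ||T u - vd||^2 + alpha TV(u) <= 1/2 ||vdag - vd||^2 + alpha TV(udag).
    The lower discrepancy bound ||T u - vd|| >= taul delta > delta says that
    the residual of [u] exceeds the one of [udag]; hence TV(u) <= TV(udag)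
    ([minimizer_TV_le]), and the source condition reduces to
    sigma ||u - udag|| <= Psi(||T u - T udag||).  The upper discrepancy bound
    and the triangle inequality ([enormD]) give
    ||T u - T udag|| <= (tauu + 1) delta.  As [Psi] is concave and vanishes at
    0, Psi((tauu + 1) delta) <= (tauu + 1) Psi(delta)
    ([index_function_scale]).  Thus the constant is essentially
    Lambda (tauu + 1) / sigma, and the estimate holds for every delta > 0. *)

Section EuclideanNorm.
Context {R : realType} {n : nat}.
Implicit Types u v w : 'cV[R]_n.

Lemma dotC u v : dot u v = dot v u.
Proof. by apply: eq_bigr => i _; rewrite mulrC. Qed.

Lemma dotDl u v w : dot (u + v) w = dot u w + dot v w.
Proof. by rewrite -big_split; apply: eq_bigr => i _; rewrite mxE mulrDl. Qed.

Lemma dotZl (a : R) u v : dot (a *: u) v = a * dot u v.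
Proof. by rewrite mulr_sumr; apply: eq_bigr => i _; rewrite mxE mulrA. Qed.

Lemma dot_ge0 u : 0 <= dot u u.
Proof. by apply: sumr_ge0 => i _; rewrite -expr2 sqr_ge0. Qed.

Lemma dot_eq0 u : dot u u = 0 -> u = 0.
Proof.
move=> /eqP; rewrite psumr_eq0 => [/allP u0|i _]; last by rewrite -expr2 sqr_ge0.
apply/colP => i; have /implyP/(_ isT) := u0 i (mem_index_enum i).
by rewrite mulf_eq0 orbb mxE => /eqP.
Qed.

Lemma dot0l v : dot 0 v = 0.
Proof. by rewrite -[0 in LHS](scale0r v) dotZl mul0r. Qed.

Lemma enorm_ge0 u : 0 <= enorm u.
Proof. exact: sqrtr_ge0. Qed.

Lemma enorm_sqr u : enorm u ^+ 2 = dot u u.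
Proof. by rewrite sqr_sqrtr // dot_ge0. Qed.

Lemma enormN u : enorm (- u) = enorm u.
Proof.
by rewrite /enorm -scaleN1r dotZl dotC dotZl mulrA mulrNN mulr1 mul1r.
Qed.

(** Cauchy-Schwarz inequality *)
Lemma dot_le_enorm u v : dot u v <= enorm u * enorm v.
Proof.
rewrite -sqrtrM ?dot_ge0 //; apply: (le_trans (ler_norm _)).
rewrite -sqrtr_sqr ler_wsqrtr //.
have [v0|v_neq0] := eqVneq (dot v v) 0.
  by rewrite (dot_eq0 _ v0) dotC !dot0l expr0n mulr0.
have v_gt0 : 0 < dot v v by rewrite lt_neqAle eq_sym v_neq0 dot_ge0.
(* The squared norm of this combination is
   (v,v) ((u,u)(v,v) - (u,v)^2). *)
have := dot_ge0 (dot v v *: u + (- dot u v) *: v).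
rewrite dotDl !dotZl ![dot _ (_ + _)]dotC !dotDl !dotZl [dot v u]dotC.
rewrite [X in 0 <= X](_ : _ = dot v v * (dot u u * dot v v - dot u v ^+ 2)).
  by rewrite pmulr_rge0 // subr_ge0.
by ring.
Qed.

Lemma enormD u v : enorm (u + v) <= enorm u + enorm v.
Proof.
rewrite -(ler_pXn2r (isT : (0 < 2)%N)) ?nnegrE ?addr_ge0 ?enorm_ge0 //.
rewrite sqrrD !enorm_sqr dotDl ![dot _ (u + v)]dotC !dotDl [dot v u]dotC.
have := dot_le_enorm u v; rewrite mulr2n; lra.
Qed.

End EuclideanNorm.

(** A concave function with value 0 at 0 is subhomogeneous. *)
Lemma index_function_scale {R : realType} (Psi : R -> R) (k t : R) :
  index_function Psi -> 1 <= k -> 0 <= t -> Psi (k * t) <= k * Psi t.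
Proof.
move=> [_ Psi_cvx _ Psi0] k1 t0; have k_gt0 : 0 < k by exact: lt_le_trans k1.
have ki0 : 0 <= k^-1 by rewrite invr_ge0 ltW.
have ki1 : k^-1 <= 1 by rewrite invf_le1.
(* [t] is the convex combination of [k * t] and 0 with weight [1 / k]. *)
have := Psi_cvx (Itv01 ki0 ki1) (k * t) 0.
rewrite !inE /= !in_itv /= !andbT => /(_ (mulr_ge0 (ltW k_gt0) t0) (lexx _)).
have -> : conv (Itv01 ki0 ki1) (k * t : convex_lmodType R^o) 0 = t.
  by rewrite [LHS](convRE (k * t) 0) /= mulr0 addr0 mulKf ?gt_eqF.
by rewrite convRE /= Psi0 oppr0 mulr0 addr0 mulrN lerN2 ler_pdivrMl.
Qed.

Section Minimizer.
Context {R : realType} {d : nat} {s : 'I_d -> nat} {N M : nat}.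
Variables (e : 'I_N -> pixel s) (T : 'cV[R]_N -> 'cV[R]_M).

Lemma objective0 (u0 u : 'cV[R]_N) (alpha : R) (v : 'cV[R]_M) :
  nonneg_orthant R N u ->
  objective e T u0 0 alpha v u
  = (2^-1 * enorm (T u - v) ^+ 2 + alpha * (TV e u - TV e u0))%:E.
Proof.
move=> u_ge0; rewrite /objective /set_indicator mem_set // adde0.
by rewrite /bregman mulmx0 dot0l subr0.
Qed.

(** A minimizer whose residual is no smaller than that of a nonnegative
    competitor has no larger total variation than this competitor. *)
Lemma minimizer_TV_le (u0 u w : 'cV[R]_N) (alpha : R) (v : 'cV[R]_M) :
  0 < alpha -> nonneg_orthant R N u -> nonneg_orthant R N w ->
  is_minimizer (objective e T u0 0 alpha v) u ->
  enorm (T w - v) <= enorm (T u - v) -> TV e u <= TV e w.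
Proof.
move=> alpha_gt0 u_ge0 w_ge0 /(_ w); rewrite !objective0 // lee_fin => min_u res.
have res2 : enorm (T w - v) ^+ 2 <= enorm (T u - v) ^+ 2.
  by rewrite ler_pXn2r // nnegrE enorm_ge0.
by rewrite -(ler_pM2l alpha_gt0); lra.
Qed.

End Minimizer.

Theorem theorem6p4 (R : realType) (taul tauu sigma Lambda : R)
    (htaul : 1 < taul) (htau : taul <= tauu)
    (hsigma : 0 < sigma <= 1) (hLambda : 0 <= Lambda) :
  exists2 C : R, 0 < C &
  forall (d : nat) (s : 'I_d -> nat) (N M : nat)
    (e : 'I_N -> pixel s) (he : bijective e)
    (T : {linear 'cV[R]_N -> 'cV[R]_M}) (hT : injective T)
    (u0 : 'cV[R]_N) (hu0 : exists c : R, u0 = const_mx c)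
    (vdag : 'cV[R]_M) (hvdag : range T vdag)
    (udag : 'cV[R]_N) (hudag : min_norm_solution T vdag udag)
    (Psi : R -> R) (hPsi : index_function Psi)
    (hsource : source_condition T (TV e) sigma Psi udag),
  \forall delta \near 0^'+,
  forall (vd : 'cV[R]_M) (hvd : enorm (vdag - vd) <= delta)
    (ua : R -> 'cV[R]_N)
    (hua : forall alpha, 0 < alpha ->
       nonneg_orthant R N (ua alpha) /\
       is_minimizer (objective e T u0 0 alpha vd) (ua alpha))
    (alpha : R)
    (halpha : (discrepancy_upper T tauu delta vd ua
               `&` discrepancy_lower T taul delta vd ua) alpha),
  total_error Lambda (ua alpha) udag <= C * Psi delta.
Proof.
have /andP[sigma_gt0 _] := hsigma.
have tauu_ge0 : 0 <= tauu + 1 by lra.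
have C0_ge0 : 0 <= Lambda * (tauu + 1) / sigma.
  by rewrite divr_ge0 ?mulr_ge0 // ltW.
(* Adding 1 keeps the constant positive when [Lambda = 0]. *)
exists (Lambda * (tauu + 1) / sigma + 1); first by rewrite ltr_wpDl.
move=> d s N M e _ T _ u0 _ vdag _ udag [udag_ge0 Tudag _] Psi hPsi hsource.
near=> delta => vd hvd ua hua alpha [[alpha_gt0 res_le] [_ res_ge]].
have delta_gt0 : 0 < delta by near: delta; exact: nbhs_right_gt.
have [ua_ge0 ua_min] := hua _ alpha_gt0.
have [Psi_ge0 _ Psi_mono _] := hPsi.
have TV_le : TV e (ua alpha) <= TV e udag.
  apply: minimizer_TV_le alpha_gt0 ua_ge0 udag_ge0 ua_min _.
  rewrite Tudag (le_trans hvd) // (le_trans _ res_ge) //.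
  by rewrite ler_peMl // ltW.
have dist_le : enorm (T (ua alpha) - T udag) <= (tauu + 1) * delta.
  rewrite Tudag -[X in enorm X](subrKA vd) mulrDl mul1r.
  apply: le_trans (enormD _ _) _; apply: lerD => //.
  by rewrite -enormN opprB.
have Psi_le : sigma * enorm (ua alpha - udag) <= (tauu + 1) * Psi delta.
  apply: le_trans (index_function_scale _ _ _ hPsi _ (ltW delta_gt0)); last lra.
  have := Psi_mono _ _ (enorm_ge0 _) dist_le; have := hsource (ua alpha); lra.
rewrite /total_error mulrDl mul1r.
apply: ler_wpDr; first exact: Psi_ge0 (ltW delta_gt0).
rewrite -!mulrA ler_wpM2l // mulrCA.
by rewrite ler_pdivlMl.
Unshelve. all: by end_near.
Qed.
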